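(* Let $I$ be a finite index set. For each positive integer $N$ and index $i\in I$ let there be given a random unitary matrix $U_i^{(N)}\in \mathrm{Mat}_N$, where for each $N$ all the $U_i^{(N)}$ ($i\in I$) are defined on a common probability space depending only on $N$. For distinct $i,i'\in I$ put $U_{ii'}^{(N)}=U_i^{(N)*}U_{i'}^{(N)}$. Make the following two assumptions. (1) For each positive integer $N$ and each deterministic signed permutation matrix $W\in \mathrm{Mat}_N$, one has equality in (joint) distribution $$\left\{W^*U_{ii'}^{(N)}W\right\}_{i,i'\in I,\ i\neq i'}\stackrel{d}{=}\left\{U_{ii'}^{(N)}\right\}_{i,i'\in I,\ i\neq i'}.$$ (2) For each positive integer $\ell$, one has $$\sup_{N\ge 1}\ \max_{i,i'\in I,\ i\neq i'}\ \max_{1\le \alpha,\beta\le N}\ \sqrt{N}\,\left\|U_{ii'}^{(N)}(\alpha,\beta)\right\|_{\ell}<\infty.$$ Then the sequence of families $\left\{\left\{U_i^{(N)}\right\}_{i\in I}\right\}_{N=1}^\infty$ is asymptotically liberating.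
   Context: $\mathrm{Mat}_N$ is the space of $N$-by-$N$ complex matrices, $A(i,j)$ is the $(i,j)$ entry of $A$, $A^*$ is the conjugate transpose, $[\![A]\!]$ is the largest singular value of $A$, and $\mathrm{tr}\,A=\sum_{i=1}^N A(i,i)$ is the unnormalized trace. For a complex random variable $Z$ and $p\in[1,\infty)$, $\|Z\|_p=(\mathbf{E}|Z|^p)^{1/p}$. A signed permutation matrix is a matrix $W\in\mathrm{Mat}_N$ with entries $W(i,j)=\epsilon_i\delta_{i,\sigma(j)}$ for some signs $\epsilon_1,\dots,\epsilon_N\in\{\pm1\}$ and some permutation $\sigma\in S_N$. Definition (asymptotically liberating). Let $I$ be a finite index set and, for each positive integer $N$ and $i\in I$, let $U_i^{(N)}\in\mathrm{Mat}_N$ be a random unitary matrix defined on a probability space depending only on $N$. The sequence of families $\{\{U_i^{(N)}\}_{i\in I}\}_{N=1}^\infty$ is asymptotically liberating if for all $i_1,\dots,i_\ell\in I$ satisfying $\ell\ge2$, $i_1\ne i_2,\ \dots,\ i_{\ell-1}\ne i_\ell$ and $i_\ell\ne i_1$, there exists a constant $c(i_1,\dots,i_\ell)$ such that $$\left|\mathbf{E}\,\mathrm{tr}\left(U_{i_1}^{(N)}A_1U_{i_1}^{(N)*}\cdots U_{i_\ell}^{(N)}A_\ell U_{i_\ell}^{(N)*}\right)\right|\le c(i_1,\dots,i_\ell)\,[\![A_1]\!]\cdots[\![A_\ell]\!]$$ for all positive integers $N$ and all constant (deterministic) matrices $A_1,\dots,A_\ell\in\mathrm{Mat}_N$ each of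 trace zero. The constant may depend on $i_1,\dots,i_\ell$ but not on $N$ or $A_1,\dots,A_\ell$. *)

(* Defs.v *)
From HB Require Import structures.
From mathcomp Require Import all_boot all_order perm all_algebra.
From mathcomp Require Import complex.
From mathcomp Require Import all_classical all_reals all_analysis.

Set Implicit Arguments.
Unset Strict Implicit.
Unset Printing Implicit Defensive.

Import Order.TTheory GRing.Theory Num.Theory.
Import numFieldNormedType.Exports.

Local Open Scope classical_set_scope.
Local Open Scope complex_scope.
Local Open Scope sesquilinear_scope.
Local Open Scope ring_scope.

(* A singular value of A is a nonnegative real square root of an eigenvalue of
   A^t* *m A. *)
Definition singular_values (R : realType) (n : nat) (A : 'M[R[i]]_n) : set R :=
  [set s | 0 <= s /\ eigenvalue (A ^t* *m A) (s ^+ 2)%:C].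

(* For n > 0 this set is finite and nonempty, so its supremum is its maximum. *)
Definition largest_singular_value (R : realType) (n : nat) (A : 'M[R[i]]_n) :
  R := sup (singular_values A).

Definition signed_permutation (R : realType) (n : nat) (W : 'M[R[i]]_n) : Prop :=
  exists (eps : 'I_n -> R[i]) (s : 'S_n),
    (forall k, eps k = 1 \/ eps k = -1) /\
    W = \matrix_(k, j) (eps k * (k == s j)%:R).

Definition random_matrix (R : realType) (d : measure_display)
    (T : measurableType d) (n : nat) (X : T -> 'M[R[i]]_n) : Prop :=
  forall a b : 'I_n,
    measurable_fun setT (fun w => complex.Re (X w a b)) /\
    measurable_fun setT (fun w => complex.Im (X w a b)).

Definition random_unitary (R : realType) (d : measure_display)
    (T : measurableType d) (n : nat) (X : T -> 'M[R[i]]_n) : Prop :=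
  random_matrix X /\ forall w, X w \is unitarymx.

Definition complex_expectation (R : realType) (d : measure_display)
    (T : measurableType d) (P : probability T R) (Z : T -> R[i]) : R[i] :=
  fine 'E_P[(fun w => complex.Re (Z w))]
    +i* fine 'E_P[(fun w => complex.Im (Z w))].

(* ||Z||_p = (E |Z|^p)^(1/p), as an extended real. *)
Definition complex_Lnorm (R : realType) (d : measure_display)
    (T : measurableType d) (P : probability T R) (p : R) (Z : T -> R[i]) :
    \bar R :=
  'N[P]_(p%:E)[(fun w => (Normc.normc (Z w))%:E)]%E.

(* The product sigma-algebra on families of matrices, generated by the real and
   imaginary parts of the entries; for finite J it is the Borel
   sigma-algebra. *)
Definition family_measurable (R : realType) (J : Type) (n : nat) :
    set (set (J -> 'M[R[i]]_n)) :=
  <<s [set S : set (J -> 'M[R[i]]_n) | exists (j : J) (a b : 'I_n) (B : set R), measurable B /\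
         (S = [set M : J -> 'M[R[i]]_n | B (complex.Re (M j a b))] \/
          S = [set M : J -> 'M[R[i]]_n | B (complex.Im (M j a b))])] >>.

Definition eq_joint_dist (R : realType) (d : measure_display)
    (T : measurableType d) (P : probability T R) (J : Type) (n : nat)
    (X Y : J -> T -> 'M[R[i]]_n) : Prop :=
  forall S : set (J -> 'M[R[i]]_n), family_measurable S ->
    P [set w | S (fun j => X j w)] = P [set w | S (fun j => Y j w)].

Definition off_diagonal (I : finType) := {p : I * I | p.1 != p.2}.

(* The random matrix U_ii' = U_i^* U_i'. *)
Definition rel_unitary (R : realType) (I : Type) (T : Type) (n : nat)
    (U : I -> T -> 'M[R[i]]_n) (i i' : I) (w : T) : 'M[R[i]]_n :=
  (U i w) ^t* *m U i' w.

(* Families indexed by matrix sizes N >= 1 are given here as families indexed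
   by n : nat, the size being N = n.+1.

   In the definition below, the letters i_1, ..., i_l are indexed by 'I_l, and
   [ordS] is the cyclic successor on 'I_l, so the last condition includes
   i_l <> i_1. The product is in the noncommutative matrix ring, in increasing
   order of k. *)
Definition asymptotically_liberating (R : realType) (I : finType)
    (d : nat -> measure_display) (T : forall n, measurableType (d n))
    (P : forall n, probability (T n) R)
    (U : forall n, I -> T n -> 'M[R[i]]_n.+1) : Prop :=
  forall (l : nat) (idx : 'I_l -> I), (2 <= l)%N ->
    (forall k, idx k != idx (ordS k)) ->
    exists c : R, forall (n : nat) (A : 'I_l -> 'M[R[i]]_n.+1),
      (forall k, \tr (A k) = 0) ->
      Normc.normc (complex_expectation (P n) (fun w =>
          \tr (\prod_(k < l)
                 (U n (idx k) w *m A k *m (U n (idx k) w) ^t*))))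
        <= c * \prod_(k < l) largest_singular_value (A k).

(* Main.v *)
Require Import Defs.
From HB Require Import structures.
From mathcomp Require Import all_boot all_order perm all_algebra.
From mathcomp Require Import complex.
From mathcomp Require Import all_classical all_reals all_analysis.
From mathcomp Require Import measurable_realfun ring lra.

(* Regard each A_k as an edge with two ends (k,1), (k,2), and let c range over
   the labellings of the 2l ends by 1, ..., N. Expanding the trace gives
     E tr(...) = sum over c of prod_k A_k(c_(k,1), c_(k,2)) * f(c),
   where f(c) is the expectation of prod_k U_(i_k i_(k+1))(c_(k,2), c_(k+1,1)).
   Conjugation by signed permutations shows that f(c) depends only on the
   kernel of c (the partition of the ends into level sets), and that f
   vanishes when some value is taken exactly once; the moment bound gives
   f(c) = O(N^(-l/2)). It remains to bound, for each kernel without singletons,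
   the sum of prod_k A_k over the c with this kernel by
   O(N^(l/2)) prod_k [[A_k]]. If every value is shared by two different edges,
   Finner's inequality bounds the sum by the product of the Frobenius norms
   of the A_k, each at most sqrt(N) [[A_k]]. Otherwise there is an isolated
   loop: the sum over its free value vanishes because tr A_k = 0, so the sum
   equals minus the sums over the kernels in which the loop is attached to
   another value, and one inducts on the number of isolated loops. *)

Set Implicit Arguments.
Unset Strict Implicit.
Unset Printing Implicit Defensive.

Import Order.TTheory GRing.Theory Num.Theory.
Import numFieldNormedType.Exports.

Local Open Scope ring_scope.

(** * Finner's inequality *)

(** Cauchy-Schwarz, read off Lagrange's identity: the squares of all the minors
    [a x * b y - a y * b x] add up to twice [S * T - D ^+ 2]. *)
Lemma sum_mul_le_sqrt (R : rcfType) (X : finType) (a b : X -> R) :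
  \sum_y a y * b y <=
    Num.sqrt (\sum_y a y ^+ 2) * Num.sqrt (\sum_y b y ^+ 2).
Proof.
set S := \sum_y a y ^+ 2; set T := \sum_y b y ^+ 2; set D := \sum_y a y * b y.
have S0 : 0 <= S by apply: sumr_ge0 => y _; exact: sqr_ge0.
have lagrange : \sum_x \sum_y (a x * b y - a y * b x) ^+ 2 =
    (S * T - D ^+ 2) *+ 2.
  transitivity (\sum_x (a x ^+ 2 * T + b x ^+ 2 * S - 2 * (a x * b x) * D)).
    apply: eq_bigr => x _; rewrite !mulr_sumr -big_split /= -sumrB.
    by apply: eq_bigr => y _; ring.
  rewrite sumrB big_split /= -!mulr_suml -mulr_sumr -/S -/T -/D; ring.
have : D ^+ 2 <= S * T.
  rewrite -subr_ge0 -(pmulrn_lge0 _ (ltn0Sn 1)) -lagrange.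
  by do 2!apply: sumr_ge0 => ? _; exact: sqr_ge0.
rewrite -sqrtrM // => /ler_wsqrtr; rewrite sqrtr_sqr.
exact: le_trans (ler_norm _).
Qed.

(** One integration step of Finner's inequality: Cauchy-Schwarz on [k1] and [k2] uses up the sum,
    and every other factor is replaced by its pointwise bound. *)
Lemma sum_prod_le (R : rcfType) (X K : finType) (a : K -> X -> R) (b : K -> R)
    (k1 k2 : K) :
  k1 != k2 -> (forall k, 0 <= b k) ->
  (forall k y, 0 <= a k y) -> (forall k y, a k y <= b k) ->
  Num.sqrt (\sum_y a k1 y ^+ 2) <= b k1 ->
  Num.sqrt (\sum_y a k2 y ^+ 2) <= b k2 ->
  \sum_y \prod_k a k y <= \prod_k b k.
Proof.
move=> k12 b0 a0 ab b1 b2; have k21 : k2 != k1 by rewrite eq_sym.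
rewrite (bigD1 k1) //= (bigD1 k2) //= mulrA.
apply: (@le_trans _ _ (\sum_y (a k1 y * a k2 y) *
    \prod_(k | (k != k1) && (k != k2)) b k)).
  apply: ler_sum => y _; rewrite (bigD1 k1) //= (bigD1 k2) //= mulrA.
  apply: ler_wpM2l; first exact: mulr_ge0.
  by apply: ler_prod => k _; rewrite a0 ab.
rewrite -mulr_suml; apply: ler_wpM2r; first exact: prodr_ge0.
apply: le_trans (sum_mul_le_sqrt _ _) _.
by apply: ler_pM => //; exact: sqrtr_ge0.
Qed.

Section IteratedSum.
Variables (R : rcfType) (V X : finType).
Implicit Types (x : {ffun V -> X}) (s : seq V) (F : {ffun V -> X} -> R).

Definition upd x v y : {ffun V -> X} := [ffun w => if w == v then y else x w].

Lemma updC x v w y z : v != w -> upd (upd x v y) w z = upd (upd x w z) v y.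
Proof.
move=> vw; apply/ffunP => u; rewrite !ffunE; have [->|//] := eqVneq u w.
by rewrite eq_sym (negbTE vw).
Qed.

(** Recursion on the list allows induction on the number of variables summed; the others stay frozen
    at [x]. *)
Fixpoint isum s F x : R :=
  if s is v :: s' then \sum_y isum s' F (upd x v y) else F x.

Lemma isum_ge0 s F x : (forall x', 0 <= F x') -> 0 <= isum s F x.
Proof.
by move=> F0; elim: s x => //= v s IH x; apply: sumr_ge0.
Qed.

Lemma isum_upd s F x v y : v \notin s ->
  (forall x', F (upd x' v y) = F x') -> isum s F (upd x v y) = isum s F x.
Proof.
move=> + Fv; elim: s x => //= w s IH x; rewrite inE negb_or => /andP[vw vs].
by apply: eq_bigr => z _; rewrite updC // IH.
Qed.

(** [isum] reaches every function that agrees with [x] off [s], possibly more than once; since [F]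
    is nonnegative, extra terms only increase it. *)
Lemma sum_le_isum s F x (E : {set {ffun V -> X}}) : (forall x', 0 <= F x') ->
  {in E, forall x', forall v, v \notin s -> x' v = x v} ->
  \sum_(x' in E) F x' <= isum s F x.
Proof.
move=> F0; elim: s x E => [|v s IH] x E xE /=.
  have sE : E \subset [set x].
    by apply/fintype.subsetP => x' /xE x'x; rewrite inE; apply/eqP/ffunP => w;
    exact: x'x.
  rewrite -[leRHS](big_set1 +%R x F) [leRHS](big_setID E) /=
    (finset.setIidPr sE).
  by rewrite lerDl; apply: sumr_ge0.
rewrite (partition_big (fun x' : {ffun V -> X} => x' v) predT) //=.
apply: ler_sum => y _.
rewrite (eq_bigl (mem [set x' in E | x' v == y])); last first.
  by move=> x'; rewrite !inE.
apply: IH => x'; rewrite inE => /andP[/xE x'x /eqP x'v] w ws; rewrite ffunE.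
by case: eqP => [->//|/eqP wv]; apply: x'x; rewrite inE negb_or wv.
Qed.

(* Finner's inequality: integrate the variables one at a time; Cauchy-Schwarz
   on two of the factors depending on the current variable pays for the sum,
   and the other factors are bounded by their l2 norm in this variable. *)
Lemma isum_prod_le (K : finType) (S : K -> pred V)
    (f : K -> {ffun V -> X} -> R) s x :
  (forall k x', 0 <= f k x') ->
  (forall k v y x', ~~ S k v -> f k (upd x' v y) = f k x') ->
  {in s, forall v, exists k1 k2, [/\ k1 != k2, S k1 v & S k2 v]} -> uniq s ->
  isum s (fun x' => \prod_k f k x') x <=
    \prod_k Num.sqrt (isum [seq v <- s | S k v] (fun x' => f k x' ^+ 2) x).
Proof.
move=> f0 fS; elim: s x => [|v s IH] x two /=.
  by move=> _; apply: ler_prod => k _; rewrite f0 sqrtr_sqr ler_norm.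
move=> /andP[vs us]; apply: le_trans.
  apply: ler_sum => y _; apply: IH => // w ws.
  by apply: two; rewrite inE ws orbT.
have sq0 k x' : 0 <= f k x' ^+ 2 by rewrite sqr_ge0.
have [k1 [k2 [k12 S1 S2]]] := two v (mem_head _ _).
have sum_sqrt k : S k v ->
  Num.sqrt (\sum_y Num.sqrt (isum [seq x <- s | S k x]
      (fun x' => f k x' ^+ 2) (upd x v y)) ^+ 2) <=
  Num.sqrt (isum (if S k v then v :: [seq x <- s | S k x]
      else [seq x <- s | S k x]) (fun x' => f k x' ^+ 2) x).
  move=> Sk; rewrite Sk /= ler_wsqrtr //; apply: ler_sum => y _.
  by rewrite sqr_sqrtr // isum_ge0.
apply: (sum_prod_le k12) => [k|k y|k y||]; rewrite ?sqrtr_ge0 ?sum_sqrt //.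
(* For a factor depending on [v], the value at [y] is one term of the sum; any other factor is
   unaffected by updating [v]. *)
apply: ler_wsqrtr; case: ifPn => [_ /=|NS].
  rewrite (bigD1 y) //= lerDl; apply: sumr_ge0 => z _; exact: isum_ge0.
rewrite isum_upd // => [|x']; last by rewrite fS.
by rewrite mem_filter (negbTE vs) andbF.
Qed.

(** For a single edge with end variables [a] and [b]. When [a = b] only the diagonal is summed,
    which is at most the full double sum. *)
Lemma isum_pair_le (a b : V) (g : X -> X -> R) s x :
  (forall y z, 0 <= g y z) -> uniq s -> s =i [:: a; b] ->
  isum s (fun x' => g (x' a) (x' b)) x <= \sum_y \sum_z g y z.
Proof.
move=> g0 us sab.
have [eab|nab] := eqVneq a b.
  have /perm_small_eq-> // : perm_eq s [:: a].
    by apply: uniq_perm => // v; rewrite sab !inE eab orbb.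
  rewrite /=; apply: ler_sum => y _; rewrite eab !ffunE eqxx (bigD1 y) //=.
  by rewrite lerDl sumr_ge0.
have nba : b != a by rewrite eq_sym.
have ps : perm_eq s [:: a; b] by apply: uniq_perm => //=; rewrite inE nab.
have := perm_size ps; case: s us sab ps => [|u [|v [|//]]] //= us sab ps _.
have := sab a; have := sab b; move: us; rewrite !inE !eqxx ?orbT /= => uv + +.
rewrite andbT in uv.
case: (eqVneq b u) uv => [<-|bu] /=.
  rewrite (negbTE nab) /= => _ _ /eqP <-.
  rewrite exchange_big /=.
  apply: ler_sum => y _; apply: ler_sum => z _.
  by rewrite !ffunE !eqxx (negbTE nba).
move=> uv /eqP bv; rewrite -bv (negbTE nab) orbF => /eqP <-.
apply: ler_sum => y _; apply: ler_sum => z _.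
by rewrite !ffunE !eqxx (negbTE nab).
Qed.

End IteratedSum.

(** * Sums over indices with a given kernel *)

Section Kernel.
Variables (K X : finType).
Implicit Types (c : {ffun K -> X * X}) (h : K * bool).

(* [c] labels the two ends of each edge in [K] by vertices in [X]; the ends are
   indexed by [K * bool]. *)
Definition half_edge c h : X := if h.2 then (c h.1).2 else (c h.1).1.

(** A Boolean table, so that kernels form a finite type along which sums can be split. *)
Definition index_kernel c : {ffun (K * bool) * (K * bool) -> bool} :=
  [ffun p => half_edge c p.1 == half_edge c p.2].

Lemma index_kernelP c c' :
  reflect (forall h h', (half_edge c h == half_edge c h') =
                        (half_edge c' h == half_edge c' h'))
    (index_kernel c == index_kernel c').
Proof.
apply: (iffP eqP) => [/ffunP cc' h h'|cc'].
  by have := cc' (h, h'); rewrite !ffunE.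
by apply/ffunP => -[h h']; rewrite !ffunE cc'.
Qed.

Lemma half_edge_inj c c' : half_edge c =1 half_edge c' -> c = c'.
Proof.
move=> cc'; apply/ffunP => k; move: (cc' (k, true)) (cc' (k, false)).
by rewrite /half_edge /= => e2 e1; apply: injective_projections.
Qed.

Definition no_single c := forall h, exists2 h', h' != h &
  half_edge c h' = half_edge c h.

Definition isolated_loop c k := ((c k).1 == (c k).2) &&
  [forall h, (h.1 != k) ==> (half_edge c h != (c k).1)].

(** When [c] and [c0] have the same kernel, this vertex map carries the labels of [c0] to those of
    [c]; [x0] is a default outside the image of [c0]. *)
Definition transport c0 c (x0 : X) : {ffun X -> X} :=
  [ffun u => if [pick h | half_edge c0 h == u] is Some h then half_edge c h
             else x0].

Lemma transportE c0 c x0 h : index_kernel c = index_kernel c0 ->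
  transport c0 c x0 (half_edge c0 h) = half_edge c h.
Proof.
move=> /eqP/index_kernelP cc0; rewrite ffunE; case: pickP => [h' e|/(_ h)].
  by apply/eqP; rewrite cc0.
by rewrite eqxx.
Qed.

(** The values taken by [c0] become the variables of Finner's inequality, and the factor of edge [k]
    depends on the one or two values at its ends. *)
Lemma sum_kernel_le (R : rcfType) (B : K -> X -> X -> R) c0 :
  (forall k y z, 0 <= B k y z) -> no_single c0 ->
  (forall k, ~~ isolated_loop c0 k) ->
  \sum_(c | index_kernel c == index_kernel c0) \prod_k B k (c k).1 (c k).2 <=
    \prod_k Num.sqrt (\sum_y \sum_z B k y z ^+ 2).
Proof.
move=> B0 two noloop.
(* With no edges there is no end to supply the default [x0], but then both sides are 1. *)
have [h0 _|H0] := pickP [pred h : K * bool | true]; last first.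
  have prod1 (F : K -> R) : \prod_k F k = 1.
    by apply: big1 => k; have := H0 (k, true).
  have cE c : c = c0 by apply/ffunP => k; have := H0 (k, true).
  rewrite (big_pred1 c0) => [|c]; last by rewrite /= (cE c) !eqxx.
  by rewrite !prod1.
pose x0 := half_edge c0 h0.
pose s := undup [seq half_edge c0 h | h : K * bool].
have sP h : half_edge c0 h \in s by rewrite mem_undup map_f // mem_enum.
pose G (x : {ffun X -> X}) := \prod_k B k (x (c0 k).1) (x (c0 k).2).
have trP c k : index_kernel c == index_kernel c0 ->
    (transport c0 c x0 (c0 k).1 = (c k).1) *
    (transport c0 c x0 (c0 k).2 = (c k).2).
  by move=> /eqP cc0; split; [exact: (transportE x0 (k, false))|
    exact: (transportE x0 (k, true))].
rewrite (eq_bigr (fun c => G (transport c0 c x0))); last first.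
  by move=> c cc0; apply: eq_bigr => k _; rewrite !trP.
(* Transport is injective on the kernel class, so the sum may be indexed by vertex maps instead of
   labellings. *)
rewrite -(big_imset G (h := fun c => transport c0 c x0)
  (A := [pred c | index_kernel c == index_kernel c0])) /=; last first.
  move=> c c' /eqP cc0 /eqP c'c0 e; apply: half_edge_inj => h.
  by rewrite -(transportE x0 h cc0) e transportE.
apply: le_trans (sum_le_isum (s := s) (x := [ffun => x0]) _ _) _.
- by move=> x; apply: prodr_ge0.
- move=> _ /imsetP[c _ ->] u us; rewrite !ffunE; case: pickP => // h /eqP hu.
  by rewrite -hu sP in us.
pose S k : pred X := mem [:: (c0 k).1; (c0 k).2].
pose f k (x : {ffun X -> X}) := B k (x (c0 k).1) (x (c0 k).2).
apply: (le_trans (@isum_prod_le _ _ _ _ S f s [ffun=> x0] _ _ _ _)).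
- by move=> k x; exact: B0.
- move=> k u y x; rewrite /S /= !inE negb_or => /andP[u1 u2].
  by rewrite /f !ffunE ![_ == u]eq_sym (negbTE u1) (negbTE u2).
- move=> u; rewrite mem_undup => /mapP[[k b] _ ->].
  have Sh h : S h.1 (half_edge c0 h).
    by case: h => k' [] /=; rewrite /S /half_edge /= !inE eqxx ?orbT.
  have [[k' b'] h'h e] := two (k, b).
  (* The second end with this value may lie on another edge. If it is the other end of [k], then [k]
     is a loop, not isolated, and a third end [h2] on another edge carries the value. *)
  have [kk'|kk'] := eqVneq k k'; last first.
    by exists k, k'; split; rewrite // ?(Sh (k, b)) // -e; exact: (Sh (k', b')).
  rewrite -kk' in h'h e.
  have loop : (c0 k).1 == (c0 k).2.
    move: h'h e; rewrite xpair_eqE eqxx /half_edge /=.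
    by case: b b' => -[] // _ ->.
  have := noloop k; rewrite /isolated_loop loop /= negb_forall => /existsP[h2].
  rewrite negb_imply negbK => /andP[h2k /eqP e2].
  exists k, h2.1; split; rewrite 1?eq_sym //; first exact: (Sh (k, b)).
  suff -> : half_edge c0 (k, b) = half_edge c0 h2 by exact: Sh.
  by rewrite e2 /half_edge /= -(eqP loop); case: (b).
- exact: undup_uniq.
apply: ler_prod => k _; rewrite sqrtr_ge0 ler_wsqrtr //.
apply: (isum_pair_le (g := fun y z => B k y z ^+ 2)) => [y z||u].
- exact: sqr_ge0.
- by rewrite filter_uniq // undup_uniq.
rewrite mem_filter /S /= !inE; case: eqP => [->|_] /=.
  exact: (sP (k, false)).
by case: eqP => // ->; exact: (sP (k, true)).
Qed.

End Kernel.

(** * Moduli of complex sums and products *)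

Lemma normc_norm (R : rcfType) (z : R[i]) : (Normc.normc z)%:C%C = `|z|.
Proof. by case: z. Qed.

Lemma normc_ge0 (R : rcfType) (z : R[i]) : 0 <= Normc.normc z.
Proof. by case: z => a b; exact: sqrtr_ge0. Qed.

Lemma normc_sum (R : rcfType) (I : Type) (r : seq I) (P : pred I)
    (F : I -> R[i]) :
  Normc.normc (\sum_(i <- r | P i) F i) <=
  \sum_(i <- r | P i) Normc.normc (F i).
Proof.
elim/big_rec2: _ => [|i x z _ xz]; first by rewrite Normc.normc0.
by apply: le_trans (le_normcD _ _) _; rewrite lerD2l.
Qed.

Lemma normc_prod (R : rcfType) (I : Type) (r : seq I) (P : pred I)
    (F : I -> R[i]) :
  Normc.normc (\prod_(i <- r | P i) F i) =
  \prod_(i <- r | P i) Normc.normc (F i).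
Proof. exact: (big_morph _ (@Normc.normcM R) (Normc.normc1 R)). Qed.

(** * Removal of isolated loops *)

Section Loops.
Variables (K X : finType).
Implicit Types (c d : {ffun K -> X * X}) (h : K * bool) (k : K).

Definition set_loop c k x : {ffun K -> X * X} :=
  [ffun j => if j == k then (x, x) else c j].

Lemma half_edge_set_loop c k x h :
  half_edge (set_loop c k x) h = if h.1 == k then x else half_edge c h.
Proof. by rewrite /half_edge ffunE; case: (h.1 == k); case: (h.2). Qed.

(* [c] has a loop at [k], anywhere, and the kernel of [c0] on the other
   edges. *)
Definition same_off k c0 c := ((c k).1 == (c k).2) &&
  [forall h, forall h', (h.1 != k) ==> (h'.1 != k) ==>
   ((half_edge c h == half_edge c h') == (half_edge c0 h == half_edge c0 h'))].

Lemma same_offP k c0 c : reflect ((c k).1 = (c k).2 /\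
    forall h h', h.1 != k -> h'.1 != k ->
    (half_edge c h == half_edge c h') = (half_edge c0 h == half_edge c0 h'))
  (same_off k c0 c).
Proof.
apply: (iffP andP) => -[/eqP ck H]; split=> //.
  move=> h h' hk h'k; move/forallP/(_ h)/forallP/(_ h'): H.
  by rewrite hk h'k => /eqP.
apply/forallP => h; apply/forallP => h'.
apply/implyP => hk; apply/implyP => h'k.
by rewrite H.
Qed.

Lemma isolated_loopP c k : reflect ((c k).1 = (c k).2 /\
    forall h, h.1 != k -> half_edge c h != (c k).1) (isolated_loop c k).
Proof.
apply: (iffP andP) => -[/eqP ck H]; split=> //.
  by move=> h hk; move/forallP/(_ h)/implyP: H; exact.
by apply/forallP => h; apply/implyP; exact: H.
Qed.

Lemma half_edge_loop c h : (c h.1).1 = (c h.1).2 -> half_edge c h = (c h.1).1.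
Proof. by rewrite /half_edge => <-; case: ifP. Qed.

(** The value at the loop [k] is free, so with all other edges fixed the inner sum is a multiple of
    the trace of [A k]. *)
Lemma sum_same_off (R : comPzRingType) (A : K -> X -> X -> R) k c0 :
  \sum_x A k x x = 0 ->
  \sum_(c | same_off k c0 c) \prod_j A j (c j).1 (c j).2 = 0.
Proof.
(* Moving the loop to the reference value [x0] gives one representative [d] for all labellings that
   differ only at [k]. *)
move=> trA; pose x0 := (c0 k).1.
rewrite (partition_big (fun c => set_loop c k x0) predT) //=.
apply: big1 => d _.
rewrite (reindex_onto (set_loop d k) (fun c => (c k).1)) /=; last first.
  move=> c /andP[/same_offP[ck _] /eqP <-]; apply/ffunP => j; rewrite !ffunE.
  case: eqP => // ->; rewrite [LHS]surjective_pairing /= {2}ck.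
  by rewrite -surjective_pairing.
have off x : same_off k c0 (set_loop d k x) = same_off k c0 (set_loop d k x0).
  apply/same_offP/same_offP => -[_ H]; split;
  rewrite ?ffunE ?eqxx // => h h' hk h'k;
  by have := H _ _ hk h'k; rewrite !half_edge_set_loop (negbTE hk) (negbTE h'k).
have set2 x : set_loop (set_loop d k x) k x0 = set_loop d k x0.
  by apply/ffunP => j; rewrite !ffunE; case: eqP.
rewrite (eq_bigl (fun=> same_off k c0 (set_loop d k x0) &&
    (set_loop d k x0 == d))).
  case: (_ && _); last by rewrite big_pred0_eq.
  rewrite (eq_bigr (fun x => A k x x * \prod_(j | j != k) A j (d j).1 (d j).2)).
    by rewrite -mulr_suml trA mul0r.
  move=> x _; rewrite (bigD1 k) //= ffunE eqxx /=; congr (_ * _).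
  by apply: eq_bigr => j jk; rewrite ffunE (negbTE jk).
by move=> x; rewrite off set2 ffunE eqxx /= eqxx andbT.
Qed.

Lemma same_off_refl k c0 : isolated_loop c0 k -> same_off k c0 c0.
Proof. by move=> /isolated_loopP[ck _]; apply/same_offP. Qed.

Lemma same_off_kernel k c0 c c' :
  index_kernel c = index_kernel c' -> same_off k c0 c = same_off k c0 c'.
Proof.
move=> /eqP/index_kernelP cc'; congr (_ && _).
  exact: (cc' (k, false) (k, true)).
by apply: eq_forallb => h; apply: eq_forallb => h'; rewrite cc'.
Qed.

(* Freeing the value at an isolated loop either gives the same kernel or
   attaches the loop to another value. *)
Lemma same_off_isolated k c0 c : isolated_loop c0 k -> same_off k c0 c ->
  index_kernel c != index_kernel c0 ->
  [set j | isolated_loop c j] \proper [set j | isolated_loop c0 j].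
Proof.
move=> /isolated_loopP[c0k iso] /same_offP[ck off] ker.
(* Were the loop [k] isolated in [c] as well, all comparisons of ends would agree with those in
   [c0]. *)
have niso : ~~ isolated_loop c k.
  apply: contra ker => /isolated_loopP[_ isoc]; apply/index_kernelP => h h'.
  have [hk|hk] := eqVneq h.1 k; have [h'k|h'k] := eqVneq h'.1 k.
  - by rewrite !half_edge_loop ?hk ?h'k // !eqxx.
  - rewrite (half_edge_loop (h := h)) ?hk //.
    rewrite (half_edge_loop (h := h)) ?hk //.
    by rewrite eq_sym (negbTE (isoc _ h'k)) eq_sym (negbTE (iso _ h'k)).
  - rewrite (half_edge_loop (h := h')) ?h'k //.
    rewrite (half_edge_loop (h := h')) ?h'k //.
    by rewrite (negbTE (isoc _ hk)) (negbTE (iso _ hk)).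
  - exact: off.
apply/properP; split; last first.
  by exists k; rewrite inE //; apply/isolated_loopP.
apply/fintype.subsetP => j; rewrite !inE => jiso.
have jk : j != k by apply: contraTneq jiso => ->.
have/isolated_loopP[cj isoj] := jiso; apply/isolated_loopP.
have jl := off (j, false) (j, true) jk jk; rewrite /half_edge /= cj eqxx in jl.
split=> [|h hj]; first exact/eqP.
(* Ends off [k] compare as in [c]; an end of [k] cannot meet the loop [j] in [c0], because [k] is
   isolated there. *)
have [hk|hk] := eqVneq h.1 k; last first.
  have := off h (j, false) hk jk; rewrite {2 4}/half_edge /= => <-.
  exact: isoj.
by rewrite half_edge_loop ?hk // eq_sym; have := iso (j, false) jk.
Qed.

(** The two ends of the loop [k] are partners of each other. An end off [k] has its partner in [c0]
    off [k] too, since [k] is isolated there, and this coincidence persists in [c]. *)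
Lemma same_off_no_single k c0 c : isolated_loop c0 k -> same_off k c0 c ->
  no_single c0 -> no_single c.
Proof.
move=> /isolated_loopP[c0k iso] /same_offP[ck off] two [j b].
have [->|jk] := eqVneq j k.
  exists (k, ~~ b); first by rewrite xpair_eqE eqxx /=; case: b.
  by rewrite !half_edge_loop.
have [h' h'h e] := two (j, b); exists h' => //.
have h'k : h'.1 != k.
  apply: contraTneq (iso (j, b) jk) => h'k.
  by rewrite -e half_edge_loop ?h'k // eqxx.
by apply/eqP; rewrite off // e.
Qed.

(** Induction on the bound [m] for the number of isolated loops. Removing one loop trades the sum
    for at most [L] sums with fewer loops, where [L] counts all Boolean tables; hence the factor
    [L ^+ m]. *)
Lemma norm_sum_kernel_le (R : rcfType) (A : K -> X -> X -> R[i]) m c0 :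
  (forall k, \sum_x A k x x = 0) -> no_single c0 ->
  (#|[set k | isolated_loop c0 k]| <= m)%N ->
  Normc.normc (\sum_(c | index_kernel c == index_kernel c0)
      \prod_k A k (c k).1 (c k).2) <=
    #|{ffun (K * bool) * (K * bool) -> bool}|%:R ^+ m *
    \prod_k Num.sqrt (\sum_y \sum_z Normc.normc (A k y z) ^+ 2).
Proof.
move=> trA; set L := #|{ffun _ -> _}|; set B := \prod_k _.
have B0 : 0 <= B by apply: prodr_ge0 => k _; exact: sqrtr_ge0.
have L1 : 1 <= L%:R :> R by rewrite ler1n /L card_ffun card_bool expn_gt0.
have base c : no_single c -> (forall k, ~~ isolated_loop c k) ->
    Normc.normc (\sum_(c' | index_kernel c' == index_kernel c)
      \prod_k A k (c' k).1 (c' k).2) <= B.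
  move=> two noloop; apply: le_trans (normc_sum _ _ _) _.
  under eq_bigr do rewrite normc_prod.
  apply: sum_kernel_le => // k y z; exact: normc_ge0.
elim: m c0 => [|m IH] c0 two.
  rewrite leqn0 cards_eq0 => /eqP/setP noloop.
  rewrite mul1r; apply: base => // k.
  by have := noloop k; rewrite !inE => ->.
have [k kiso cardS|noloop _] := pickP (isolated_loop c0); last first.
  apply: le_trans (base _ two _) _ => [k|]; first by rewrite noloop.
  by rewrite ler_peMl // exprn_ege1.
have := sum_same_off c0 (trA k).
rewrite (partition_big (@index_kernel K X) predT) //=.
rewrite (bigD1 (index_kernel c0)) //=.
rewrite (eq_bigl (fun c => index_kernel c == index_kernel c0)); last first.
  move=> c; apply: andb_idl => /eqP cc0.
  by rewrite (same_off_kernel _ _ cc0) same_off_refl.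
move=> /eqP; rewrite addr_eq0 => /eqP ->; rewrite normcN.
apply: le_trans (normc_sum _ _ _) _.
rewrite exprS -mulrA; set M := _ * B.
have M0 : 0 <= M by rewrite mulr_ge0 // exprn_ge0.
apply: (@le_trans _ _ (\sum_(q : {ffun (K * bool) * (K * bool) -> bool} |
    q != index_kernel c0) M)).
  apply: ler_sum => q qc0.
  (* [same_off] depends only on the kernel, so the class of [q] is either entirely present, and the
     induction hypothesis applies, or absent. *)
  have [c1 /andP[c1off /eqP c1q]|none] := pickP
    (fun c => same_off k c0 c && (index_kernel c == q)).
    rewrite (eq_bigl (fun c => index_kernel c == index_kernel c1)); last first.
      move=> c; rewrite c1q; apply: andb_idl; rewrite -c1q => /eqP cc1.
      by rewrite (same_off_kernel _ _ cc1).
    apply: IH; first exact: same_off_no_single c1off two.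
    rewrite -ltnS (leq_trans _ cardS) // proper_card //.
    by apply: same_off_isolated c1off _; rewrite // c1q.
  by rewrite big_pred0 // Normc.normc0.
rewrite sumr_const -[leLHS]mulr_natl; apply: ler_wpM2r => //.
by rewrite ler_nat max_card.
Qed.

End Loops.

Local Open Scope classical_set_scope.
Local Open Scope complex_scope.
Local Open Scope sesquilinear_scope.
Local Open Scope ring_scope.

(** * Trace expansion and singular values *)

(** Each inner factor [y k *m x k.+1] is a 1-by-1 matrix and comes out as a scalar. Indexing by
    [nat] keeps the induction free of ordinal casts. *)
Lemma prod_rank_one (R : comNzRingType) n (x : nat -> 'cV[R]_n.+1)
    (y : nat -> 'rV[R]_n.+1) m :
  \prod_(k < m.+1) (x k *m y k) =
    (\prod_(k < m) (y k *m x k.+1) 0 0) *: (x 0%N *m y m).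
Proof.
elim: m => [|m IH]; first by rewrite big_ord_recl !big_ord0 mulr1 scale1r.
rewrite big_ord_recr IH [in RHS]big_ord_recr /= -scalerA -scalerAl.
congr (_ *: _); rewrite -mulmxE -mulmxA (mulmxA (y m)).
by rewrite [y m *m _ in LHS]mx11_scalar mul_scalar_mx -scalemxAr.
Qed.

(** Cyclicity of the trace turns the remaining [x 0 *m y m] into the scalar that closes the
    cycle. *)
Lemma tr_prod_rank_one (R : comNzRingType) n m (x : 'I_m.+1 -> 'cV[R]_n.+1)
    (y : 'I_m.+1 -> 'rV[R]_n.+1) :
  \tr (\prod_(k < m.+1) (x k *m y k)) =
  \prod_(k < m.+1) (y k *m x (ordS k)) 0 0.
Proof.
have := prod_rank_one (fun k => x (inord k)) (fun k => y (inord k)) m.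
under eq_bigr do rewrite inord_val; move=> ->.
rewrite mxtraceZ mxtrace_mulC /mxtrace big_ord1 big_ord_recr /=.
congr (_ * _).
  apply: eq_bigr => k _.
  have -> : inord k = widen_ord (leqnSn m) k.
    by apply: val_inj; rewrite /= inordK // ltnS ltnW.
  congr ((_ *m x _) _ _); apply: val_inj.
  by rewrite /= modn_small ?inordK // ltnS ltn_ord.
have -> : inord m = ord_max :> 'I_m.+1 by apply: val_inj; rewrite /= inordK.
by congr ((_ *m x _) _ _); apply: val_inj; rewrite /= inordK // modnn.
Qed.

(** Each factor is a combination of rank-one matrices, a column of [U k] times a row of [V k];
    distributing the product selects one such pair per [k], recorded in [c]. *)
Lemma tr_prod_conj (R : comNzRingType) n m (U A V : 'I_m.+1 -> 'M[R]_n.+1) :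
  \tr (\prod_(k < m.+1) (U k *m A k *m V k)) =
  \sum_(c : {ffun 'I_m.+1 -> 'I_n.+1 * 'I_n.+1})
    (\prod_k A k (c k).1 (c k).2) *
     \prod_k (V k *m U (ordS k)) (c k).2 (c (ordS k)).1.
Proof.
have expand k : U k *m A k *m V k =
    \sum_(p : 'I_n.+1 * 'I_n.+1)
      A k p.1 p.2 *: (col p.1 (U k) *m row p.2 (V k)).
  apply/matrixP => i j; rewrite summxE mxE.
  under eq_bigr do rewrite mxE mulr_suml.
  rewrite /= exchange_big pair_big /=; apply: eq_bigr => p _.
  by rewrite !mxE big_ord1 !mxE mulrA [A k _ _ * _]mulrC.
under eq_bigr do rewrite expand.
rewrite bigA_distr_bigA raddf_sum /=; apply: eq_bigr => c _.
rewrite scaler_prod mxtraceZ tr_prod_rank_one; congr (_ * _).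
by apply: eq_bigr => k _; rewrite !mxE; apply: eq_bigr => j _; rewrite !mxE.
Qed.

Lemma signed_permutation_conj (R : realType) n (eps : 'I_n -> R[i]) (s : 'S_n)
    (V : 'M[R[i]]_n) a b :
  (forall k, eps k = 1 \/ eps k = -1) ->
  let W := \matrix_(k, j) (eps k * (k == s j)%:R) in
  (W ^t* *m V *m W) a b = eps (s a) * eps (s b) * V (s a) (s b).
Proof.
move=> eps1 /=; rewrite mxE (bigD1 (s b)) //= [X in _ + X]big1; last first.
  by move=> k kb; rewrite !mxE (negbTE kb) mulr0 mulr0.
rewrite !mxE eqxx mulr1 addr0 (bigD1 (s a)) //= big1 => [|k ka]; last first.
  by rewrite !mxE (negbTE ka) mulr0 rmorph0 mul0r.
rewrite !mxE eqxx mulr1 addr0 mulrAC.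
by case: (eps1 (s a)) => ->; rewrite ?rmorphN rmorph1.
Qed.

(** * Frobenius norm and largest singular value *)

Section Frobenius.
Variables (R : realType) (n : nat) (A : 'M[R[i]]_n.+1).

Let B := A ^t* *m A.
Let P := spectralmx B.
Let D := spectral_diag B.

Let BE : B = P ^t* *m diag_mx D *m P.
Proof.
rewrite -invmx_unitary ?spectral_unitarymx //.
apply/orthomx_spectralP/normalmxP.
have -> : B ^t* = B by rewrite /B trmx_mul map_mxM trmxCK.
by [].
Qed.

Let PP : P *m P ^t* = 1%:M.
Proof. exact/unitarymxP/spectral_unitarymx. Qed.

Let PBP : P *m B *m P ^t* = diag_mx D.
Proof. by rewrite BE !mulmxA PP mul1mx -mulmxA PP mulmx1. Qed.

Let D_ge0 i : 0 <= D 0 i.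
Proof.
have -> : D 0 i = diag_mx D i i by rewrite mxE eqxx mulr1n.
rewrite -PBP /B mulmxA -mulmxA.
have -> : A *m P^t* = (P *m A^t*) ^t* by rewrite trmx_mul map_mxM trmxCK.
move: (P *m A ^t*) => Q; rewrite mxE; apply: sumr_ge0 => j _.
have -> : (Q ^t*) j i = Num.conj (Q i j) by rewrite 2!mxE.
exact: mul_conjC_ge0.
Qed.

Let trB : \tr B = \sum_i D 0 i.
Proof.
by rewrite -mxtrace_diag -PBP [RHS]mxtrace_mulC mulmxA (mulmx1C PP) mul1mx.
Qed.

Let frobenius : (\sum_i \sum_j Normc.normc (A i j) ^+ 2)%:C = \tr B.
Proof.
rewrite exchange_big /= rmorph_sum; apply: eq_bigr => j _.
rewrite rmorph_sum mxE; apply: eq_bigr => i _.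
by rewrite rmorphXn /= normc_norm !mxE normCKC.
Qed.

Let sing i : singular_values A (Num.sqrt (complex.Re (D 0 i))).
Proof.
split; first exact: sqrtr_ge0.
have DR : (complex.Re (D 0 i))%:C = D 0 i.
  by rewrite RRe_real // ger0_real.
have D0 : 0 <= complex.Re (D 0 i) by rewrite -ler0c DR.
rewrite sqr_sqrtr // DR; apply/eigenvalueP; exists (row i P).
  rewrite -row_mul -/B; have -> : P *m B = diag_mx D *m P.
    by rewrite BE !mulmxA PP mul1mx.
  by rewrite row_mul row_diag_mx -scalemxAl -rowE.
apply/eqP => P0; have /rowP/(_ i) := congr1 (mulmx^~ (P ^t*)) P0.
by rewrite -row_mul PP mul0mx !mxE eqxx => /eqP; rewrite oner_eq0.
Qed.

(** Needed for the supremum to dominate each singular value. The square of a singular value is some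
    [D 0 i], hence at most [\tr B], and [s <= 1 + s ^+ 2]. *)
Let sing_ub : has_ubound (singular_values A).
Proof.
exists (1 + complex.Re (\tr B)) => s [s0 /eigenvalueP[v vB v0]].
have vP0 : v *m P ^t* != 0.
  apply: contraNneq v0 => vPt0.
  by rewrite -[v]mulmx1 -(mulmx1C PP) mulmxA vPt0 mul0mx.
(* In the coordinates [v *m P ^t*] the matrix [B] is diagonal, so a nonzero coordinate identifies
   the eigenvalue. *)
have [i vi] : exists i, (v *m P^t*) 0 i != 0.
  apply/existsP; apply: contraNT vP0; rewrite negb_exists => /forallP H.
  apply/eqP/rowP => i; rewrite [RHS]mxE; apply/eqP.
  by have := H i; rewrite negbK.
have : (s ^+ 2)%:C = D 0 i.
  apply: (mulfI vi).
  have /rowP/(_ i) : (v *m P^t*) *m diag_mx D = (s ^+ 2)%:C *: (v *m P^t*).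
    rewrite -PBP -mulmxA -(mulmxA P) (mulmxA (P ^t*)) (mulmx1C PP) mul1mx.
    by rewrite (mulmxA v B) vB -scalemxAl.
  rewrite mul_mx_diag [LHS]mxE [RHS]mxE => ->; exact: mulrC.
move=> sD; have : (s ^+ 2)%:C <= \tr B.
  rewrite sD trB (bigD1 i) //= lerDl; apply: sumr_ge0 => j _; exact: D_ge0.
rewrite -frobenius /= lecR; set F := \sum_i _ => sF.
nra.
Qed.

Lemma largest_singular_value_ge0 : 0 <= largest_singular_value A.
Proof.
apply: le_trans (sqrtr_ge0 (complex.Re (D 0 ord0))) _.
exact: (ub_le_sup sing_ub (sing ord0)).
Qed.

(** The squared Frobenius norm is [\tr B], a sum of [n.+1] eigenvalues, each the square of a
    singular value. *)
Lemma frobenius_le :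
  Num.sqrt (\sum_i \sum_j Normc.normc (A i j) ^+ 2) <=
    Num.sqrt n.+1%:R * largest_singular_value A.
Proof.
have s0 := largest_singular_value_ge0.
rewrite -(ger0_norm s0) -sqrtr_sqr -sqrtrM //; apply: ler_wsqrtr.
rewrite -lecR frobenius trB.
have -> : (n.+1%:R * largest_singular_value A ^+ 2)%:C =
    \sum_(i < n.+1) (largest_singular_value A ^+ 2)%:C.
  by rewrite sumr_const card_ord rmorphM rmorph_nat mulr_natl.
apply: ler_sum => i _.
have DR : (complex.Re (D 0 i))%:C = D 0 i.
  by rewrite RRe_real // ger0_real.
have D0 : 0 <= complex.Re (D 0 i) by rewrite -ler0c DR.
rewrite -DR lecR -[leLHS](sqr_sqrtr D0) ler_sqr ?nnegrE ?sqrtr_ge0 //.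
exact: (ub_le_sup sing_ub (sing i)).
Qed.

End Frobenius.

(** * Expectations of complex random variables *)

Section ComplexMeasurable.
Context d (T : measurableType d) (R : realType).
Implicit Types Z : T -> R[i].

Definition complex_measurable Z :=
  measurable_fun setT (fun w => complex.Re (Z w)) /\
  measurable_fun setT (fun w => complex.Im (Z w)).

Lemma complex_measurable_cst z : complex_measurable (cst z).
Proof. by split; exact: measurable_cst. Qed.

Lemma complex_measurableD Z Z' : complex_measurable Z ->
  complex_measurable Z' -> complex_measurable (fun w => Z w + Z' w).
Proof.
move=> [mR mI] [mR' mI']; split.
  have -> : (fun w => complex.Re (Z w + Z' w)) =
      (fun w => complex.Re (Z w)) \+ (fun w => complex.Re (Z' w)).
    by apply/funext => w /=; case: (Z w) (Z' w) => a b [].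
  exact: measurable_funD.
have -> : (fun w => complex.Im (Z w + Z' w)) =
    (fun w => complex.Im (Z w)) \+ (fun w => complex.Im (Z' w)).
  by apply/funext => w /=; case: (Z w) (Z' w) => a b [].
exact: measurable_funD.
Qed.

Lemma complex_measurableM Z Z' : complex_measurable Z ->
  complex_measurable Z' -> complex_measurable (fun w => Z w * Z' w).
Proof.
move=> [mR mI] [mR' mI']; split.
  have -> : (fun w => complex.Re (Z w * Z' w)) =
      (fun w => complex.Re (Z w) * complex.Re (Z' w) -
                complex.Im (Z w) * complex.Im (Z' w)).
    by apply/funext => w /=; case: (Z w) (Z' w) => a b [].
  by apply: measurable_funB; apply: measurable_funM.
have -> : (fun w => complex.Im (Z w * Z' w)) =
    (fun w => complex.Re (Z w) * complex.Im (Z' w) +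
              complex.Im (Z w) * complex.Re (Z' w)).
  by apply/funext => w /=; case: (Z w) (Z' w) => a b [].
by apply: measurable_funD; apply: measurable_funM.
Qed.

Lemma complex_measurable_conj Z :
  complex_measurable Z -> complex_measurable (fun w => Num.conj (Z w)).
Proof.
move=> [mR mI]; split.
  by apply: eq_measurable_fun mR => w _; case: (Z w).
apply: eq_measurable_fun (measurable_funN mI) => w _ /=; by case: (Z w).
Qed.

Lemma complex_measurable_sum (I : Type) (r : seq I) (F : I -> T -> R[i]) :
  (forall k, complex_measurable (F k)) ->
  complex_measurable (fun w => \sum_(k <- r) F k w).
Proof.
move=> mF; elim: r => [|k r IH].
  by under eq_fun do rewrite big_nil; exact: complex_measurable_cst.
by under eq_fun do rewrite big_cons; exact: complex_measurableD.
Qed.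

Lemma complex_measurable_prod (I : Type) (r : seq I) (F : I -> T -> R[i]) :
  (forall k, complex_measurable (F k)) ->
  complex_measurable (fun w => \prod_(k <- r) F k w).
Proof.
move=> mF; elim: r => [|k r IH].
  by under eq_fun do rewrite big_nil; exact: complex_measurable_cst.
by under eq_fun do rewrite big_cons; exact: complex_measurableM.
Qed.

Lemma measurable_normc Z : complex_measurable Z ->
  measurable_fun setT (fun w => Normc.normc (Z w)).
Proof.
move=> [mR mI].
have -> : (fun w => Normc.normc (Z w)) = (@Num.sqrt R) \o
    ((fun w => complex.Re (Z w) ^+ 2) \+ (fun w => complex.Im (Z w) ^+ 2)).
  by apply/funext => w /=; case: (Z w).
apply: measurableT_comp.
  by apply: continuous_measurable_fun; exact: sqrt_continuous.
by apply: measurable_funD; exact: measurable_funX.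
Qed.

End ComplexMeasurable.

Lemma normr_Re_le (R : realType) (z : R[i]) : `|complex.Re z| <= Normc.normc z.
Proof.
case: z => a b /=; rewrite -sqrtr_sqr ler_wsqrtr // lerDl; exact: sqr_ge0.
Qed.

Lemma normr_Im_le (R : realType) (z : R[i]) : `|complex.Im z| <= Normc.normc z.
Proof.
case: z => a b /=; rewrite -sqrtr_sqr ler_wsqrtr // lerDr; exact: sqr_ge0.
Qed.

Lemma normc_ReIm_le (R : realType) (a b : R) :
  Normc.normc (a +i* b) <= `|a| + `|b|.
Proof.
have h : 0 <= `|a| + `|b| by rewrite addr_ge0.
rewrite /= -(ger0_norm h) -sqrtr_sqr ler_wsqrtr //.
by rewrite sqrrD !real_normK ?num_real // lerD2r lerDl mulrn_wge0 // mulr_ge0.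
Qed.

Section Expectation.
Context d (T : measurableType d) (R : realType) (P : probability T R).
Implicit Types Z : T -> R[i].

(** Products of entries of unitary matrices are bounded, and on a probability space boundedness
    settles every integrability condition. *)
Definition bounded_measurable Z :=
  complex_measurable Z /\ exists M, forall w, Normc.normc (Z w) <= M.

Lemma bounded_measurable_cst z : bounded_measurable (cst z).
Proof.
by split; [exact: complex_measurable_cst | exists (Normc.normc z)].
Qed.

Lemma bounded_measurableD Z Z' : bounded_measurable Z ->
  bounded_measurable Z' -> bounded_measurable (fun w => Z w + Z' w).
Proof.
move=> [mZ [M ZM]] [mZ' [M' ZM']]; split; first exact: complex_measurableD.
by exists (M + M') => w; apply: le_trans (le_normcD _ _) _; exact: lerD.
Qed.

Lemma bounded_measurableM Z Z' : bounded_measurable Z ->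
  bounded_measurable Z' -> bounded_measurable (fun w => Z w * Z' w).
Proof.
move=> [mZ [M ZM]] [mZ' [M' ZM']]; split; first exact: complex_measurableM.
by exists (M * M') => w; rewrite Normc.normcM ler_pM ?normc_ge0.
Qed.

Lemma bounded_measurable_sum (I : Type) (r : seq I) (F : I -> T -> R[i]) :
  (forall k, bounded_measurable (F k)) ->
  bounded_measurable (fun w => \sum_(k <- r) F k w).
Proof.
move=> mF; elim: r => [|k r IH].
  by under eq_fun do rewrite big_nil; exact: bounded_measurable_cst.
by under eq_fun do rewrite big_cons; exact: bounded_measurableD.
Qed.

Lemma bounded_measurable_prod (I : Type) (r : seq I) (F : I -> T -> R[i]) :
  (forall k, bounded_measurable (F k)) ->
  bounded_measurable (fun w => \prod_(k <- r) F k w).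
Proof.
move=> mF; elim: r => [|k r IH].
  by under eq_fun do rewrite big_nil; exact: bounded_measurable_cst.
by under eq_fun do rewrite big_cons; exact: bounded_measurableM.
Qed.

Lemma integrable_bounded (f : T -> R) M : measurable_fun setT f ->
  (forall w, `|f w| <= M) -> P.-integrable setT (EFin \o f).
Proof.
move=> mf fM; apply: measurable_bounded_integrable => //.
  exact: le_lt_trans (probability_le1 P measurableT) (ltry _).
exists M; split; first exact: num_real.
by move=> y My w _; apply: ltW; exact: le_lt_trans (fM w) My.
Qed.

Lemma integrable_Re Z : bounded_measurable Z ->
  P.-integrable setT (EFin \o (fun w => complex.Re (Z w))).
Proof.
move=> [[mR _] [M ZM]]; apply: (integrable_bounded mR) => w.
exact: le_trans (normr_Re_le _) (ZM w).
Qed.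

Lemma integrable_Im Z : bounded_measurable Z ->
  P.-integrable setT (EFin \o (fun w => complex.Im (Z w))).
Proof.
move=> [[_ mI] [M ZM]]; apply: (integrable_bounded mI) => w.
exact: le_trans (normr_Im_le _) (ZM w).
Qed.

Local Notation E := (complex_expectation P).

Lemma complex_expectationE Z :
  E Z = (\int[P]_w complex.Re (Z w))%R +i* (\int[P]_w complex.Im (Z w))%R.
Proof. by rewrite /complex_expectation !unlock. Qed.

Lemma complex_expectationD Z Z' : bounded_measurable Z ->
  bounded_measurable Z' -> E (fun w => Z w + Z' w) = E Z + E Z'.
Proof.
move=> bZ bZ'; rewrite !complex_expectationE /=.
rewrite [RHS]/GRing.add /=.
congr (_ +i* _).
  rewrite -RintegralD //; [|exact: integrable_Re|exact: integrable_Re].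
  by apply: eq_Rintegral => w _; case: (Z w) (Z' w) => a b [].
rewrite -RintegralD //; [|exact: integrable_Im|exact: integrable_Im].
by apply: eq_Rintegral => w _; case: (Z w) (Z' w) => a b [].
Qed.

Lemma complex_expectationZl z Z : bounded_measurable Z ->
  E (fun w => z * Z w) = z * E Z.
Proof.
move=> bZ; have iR := integrable_Re bZ; have iI := integrable_Im bZ.
case: z => a b; rewrite !complex_expectationE [RHS]/GRing.mul /=.
have bM c c' : P.-integrable setT (EFin \o (fun w => c * complex.Re (Z w))) *
    P.-integrable setT (EFin \o (fun w => c' * complex.Im (Z w))).
  split; [exact: (integrableZl _ c iR)|exact: (integrableZl _ c' iI)].
congr (_ +i* _).
  rewrite -!RintegralZl // -RintegralB //;
    [|exact: (bM a b).1|exact: (bM a b).2].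
  by apply: eq_Rintegral => w _; case: (Z w).
rewrite -!RintegralZl // -RintegralD //; [|exact: (bM b a).2|exact: (bM b a).1].
by apply: eq_Rintegral => w _; case: (Z w).
Qed.

Lemma complex_expectation_sum (I : Type) (r : seq I) (a : I -> R[i])
    (F : I -> T -> R[i]) :
  (forall k, bounded_measurable (F k)) ->
  E (fun w => \sum_(k <- r) a k * F k w) = \sum_(k <- r) a k * E (F k).
Proof.
move=> bF; elim: r => [|k r IH].
  rewrite big_nil; under eq_fun do rewrite big_nil.
  rewrite complex_expectationE /=.
  by rewrite !Rintegral_cst // mul0r.
rewrite big_cons; under eq_fun do rewrite big_cons.
have baF j : bounded_measurable (fun w => a j * F j w).
  by apply: bounded_measurableM => //; exact: bounded_measurable_cst.
rewrite complex_expectationD ?complex_expectationZl ?IH //.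
exact: bounded_measurable_sum.
Qed.

End Expectation.

(** * Expectations under equality in joint distribution *)

Section JointDistribution.
Context d (T : measurableType d) (R : realType) (P : probability T R).
Variables (J : Type) (n : nat).

(** The alias carries the choice and pointed structures declared next. *)
Definition matrix_family : Type := J -> 'M[R[i]]_n.

HB.instance Definition _ := gen_eqMixin matrix_family.
HB.instance Definition _ := gen_choiceMixin matrix_family.
HB.instance Definition _ := isPointed.Build matrix_family (fun=> 0).

(* The generators of [family_measurable], so that [eq_joint_dist] applies to
   the measurable sets of [g_sigma_algebraType entry_cylinders]. *)
Definition entry_cylinders : set (set matrix_family) :=
  [set S : set (J -> 'M[R[i]]_n) |
    exists (j : J) (a b : 'I_n) (B : set R), measurable B /\
         (S = [set M : J -> 'M[R[i]]_n | B (complex.Re (M j a b))] \/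
          S = [set M : J -> 'M[R[i]]_n | B (complex.Im (M j a b))])].

Lemma complex_measurable_entry j a b :
  complex_measurable (fun M : g_sigma_algebraType entry_cylinders => M j a b).
Proof.
split => _ B mB; rewrite setTI; apply: sub_sigma_algebra;
  exists j, a, b, B; split => //.
  by left.
by right.
Qed.

(** Each side is the integral of the identity against a law on the line; the laws agree because [f]
    pulls Borel sets back to [family_measurable] sets. *)
Lemma eq_joint_dist_Rintegral (X Y : J -> T -> 'M[R[i]]_n)
    (f : g_sigma_algebraType entry_cylinders -> R) :
  eq_joint_dist P X Y -> measurable_fun setT f ->
  let fX w := f (fun j => X j w) in let fY w := f (fun j => Y j w) in
  measurable_fun setT fX -> measurable_fun setT fY ->
  P.-integrable setT (EFin \o fX) -> P.-integrable setT (EFin \o fY) ->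
  (\int[P]_w fX w = \int[P]_w fY w)%R.
Proof.
move=> XY mf fX fY mX mY iX iY; congr fine.
have push (g : T -> R) : measurable_fun setT g ->
    P.-integrable setT (EFin \o g) ->
    (\int[P]_w (g w)%:E = \int[pushforward P g]_y y%:E)%E.
  by move=> mg ig; rewrite integral_pushforward.
rewrite !push //; apply: eq_measure_integral => A mA _.
have := XY (f @^-1` A) _; apply.
by have := mf measurableT A mA; rewrite setTI.
Qed.

Lemma eq_joint_dist_expectation (X Y : J -> T -> 'M[R[i]]_n)
    (phi : g_sigma_algebraType entry_cylinders -> R[i]) :
  eq_joint_dist P X Y -> complex_measurable phi ->
  bounded_measurable (fun w => phi (fun j => X j w)) ->
  bounded_measurable (fun w => phi (fun j => Y j w)) ->
  complex_expectation P (fun w => phi (fun j => X j w)) =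
  complex_expectation P (fun w => phi (fun j => Y j w)).
Proof.
move=> XY [mR mI] bX bY; rewrite !complex_expectationE; congr (_ +i* _).
  apply: (eq_joint_dist_Rintegral XY mR).
  - exact: bX.1.1.
  - exact: bY.1.1.
  - exact: integrable_Re bX.
  - exact: integrable_Re bY.
apply: (eq_joint_dist_Rintegral XY mI).
- exact: bX.1.2.
- exact: bY.1.2.
- exact: integrable_Im bX.
- exact: integrable_Im bY.
Qed.

End JointDistribution.

(** * Expectation bounds from moments *)

Section Moments.
Context d (T : measurableType d) (R : realType) (P : probability T R).

Lemma moment_le (Z : T -> R[i]) (l : nat) (b : R) :
  (0 < l)%N -> (complex_Lnorm P l%:R Z <= b%:E)%E ->
  (\int[P]_w ((Normc.normc (Z w)) ^+ l)%:E <= (b ^+ l)%:E)%E.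
Proof.
move=> l0 Zb.
have b0 : 0 <= b by rewrite -lee_fin (le_trans _ Zb) // Lnorm_ge0.
have -> : (\int[P]_w ((Normc.normc (Z w)) ^+ l)%:E =
    complex_Lnorm P l%:R Z `^ l%:R)%E.
  rewrite poweR_Lnorm ?pnatr_eq0 -?lt0n //; apply: eq_integral => w _ /=.
  by rewrite powR_mulrn // ger0_norm ?normc_ge0.
rewrite -powR_mulrn // -poweR_EFin; apply: gt0_ler_poweR => //.
- by rewrite in_itv /= Lnorm_ge0 leey.
- by rewrite in_itv /= lee_fin b0 leey.
Qed.

(** Real and imaginary parts are estimated separately, which costs the factor 2. The intended [Z] is
    a product, dominated by powers of its factors. *)
Lemma normc_expectation_le (K : finType) (Y : K -> T -> R[i]) (l : nat) (b : R)
    (Z : T -> R[i]) :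
  bounded_measurable Z -> (forall k, complex_measurable (Y k)) ->
  (forall w, Normc.normc (Z w) <= \sum_k Normc.normc (Y k w) ^+ l) ->
  (forall k, (\int[P]_w ((Normc.normc (Y k w)) ^+ l)%:E <= b%:E)%E) ->
  Normc.normc (complex_expectation P Z) <= (#|K|%:R * b) *+ 2.
Proof.
move=> bZ mY ZY Yb.
have bound (f : T -> R) : measurable_fun setT f ->
    P.-integrable setT (EFin \o f) -> (forall w, `|f w| <= Normc.normc (Z w)) ->
    `|\int[P]_w f w|%R <= #|K|%:R * b.
  move=> mf fi fZ; rewrite -lee_fin EFin_normr_Rintegral //.
  apply: le_trans (le_abse_integral _ _ _) _ => //.
    exact/measurable_EFinP.
  apply: (@le_trans _ _ (\int[P]_w (\sum_k (Normc.normc (Y k w) ^+ l)%:E))%E).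
    apply: ge0_le_integral => //.
    - by apply: measurableT_comp => //; exact/measurable_EFinP.
    - apply: emeasurable_sum => k; apply/measurable_EFinP.
      by apply: measurable_funX; exact: measurable_normc.
    - by move=> w _; rewrite sumEFin lee_fin (le_trans (fZ w)).
  rewrite ge0_integral_sum //.
  - apply: (@le_trans _ _ (\sum_(k : K) b%:E)%E); first exact: lee_sum.
    by rewrite sumEFin sumr_const mulr_natl.
  - move=> k; apply/measurable_EFinP; apply: measurable_funX.
    exact: measurable_normc.
  - by move=> k w _; rewrite lee_fin exprn_ge0 // normc_ge0.
rewrite complex_expectationE; apply: le_trans (normc_ReIm_le _ _) _.
rewrite mulr2n; apply: lerD; apply: bound.
- exact: bZ.1.1.
- exact: integrable_Re.
- by move=> w; exact: normr_Re_le.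
- exact: bZ.1.2.
- exact: integrable_Im.
- by move=> w; exact: normr_Im_le.
Qed.

End Moments.

(** A substitute for Hölder's inequality: the largest factor raised to the number of factors
    dominates the product and is one term of the sum. *)
Lemma prod_le_sum_pow (R : realDomainType) (K : finType) (k0 : K) (a : K -> R) :
  (forall k, 0 <= a k) -> \prod_k a k <= \sum_k a k ^+ #|K|.
Proof.
move=> a0; have [k _ ak] := arg_maxP a (isT : xpredT k0).
apply: (@le_trans _ _ (\prod_(j : K) a k)).
  by apply: ler_prod => j _; rewrite a0; exact: ak.
rewrite prodr_const (bigD1 k) //= lerDl; apply: sumr_ge0 => j _.
exact: exprn_ge0.
Qed.

Lemma unitarymx_entry_le1 (R : realType) n (M : 'M[R[i]]_n) a b :
  M \is unitarymx -> Normc.normc (M a b) <= 1.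
Proof.
move=> /unitarymxP/matrixP/(_ a a); rewrite !mxE eqxx mulr1n => M1.
rewrite -lecR normc_norm -(ler_pXn2r (ltn0Sn 1)) ?nnegrE // expr1n -[leRHS]M1.
rewrite (bigD1 b) //= !mxE -normCK lerDl; apply: sumr_ge0 => j _.
rewrite !mxE; exact: mul_conjC_ge0.
Qed.

(** * Moments of the relative unitaries *)

(** Equal kernels make the transport map injective on the values of [c], and an injection between
    subsets of a finite set extends to a permutation. *)
Lemma perm_of_kernel (K X : finType) (c c' : {ffun K -> X * X}) :
  index_kernel c = index_kernel c' ->
  exists s : {perm X}, forall h, half_edge c' h = s (half_edge c h).
Proof.
move=> cc'; have [h0 _|H0] := pickP [pred h : K * bool | true]; last first.
  by exists 1%g => h; have := H0 h.
pose x0 := half_edge c h0; pose t := transport c c' x0.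
have tE h : t (half_edge c h) = half_edge c' h by exact: transportE.
pose im := undup [seq half_edge c h | h : K * bool].
have imP h : half_edge c h \in im by rewrite mem_undup map_f // mem_enum.
have im_inj : {in im &, injective t}.
  move=> u v; rewrite !mem_undup => /mapP[h _ ->] /mapP[h' _ ->].
  by rewrite !tE => /eqP e; apply/eqP; move/eqP/index_kernelP: cc' => ->.
pose extend (r : seq X) := r ++ [seq x <- enum X | x \notin r].
have extend_uniq r : uniq r -> uniq (extend r).
  move=> ur; rewrite cat_uniq ur filter_uniq ?enum_uniq // andbT /=.
  by apply/hasPn => x; rewrite mem_filter => /andP[].
have mem_extend r x : x \in extend r.
  by rewrite mem_cat mem_filter mem_enum andbT orbN.
have size_extend r : uniq r -> size (extend r) = #|X|.
  move=> /extend_uniq/card_uniqP <-; apply: eq_card => x.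
  by rewrite mem_extend.
have u1 : uniq im by exact: undup_uniq.
have u2 : uniq (map t im) by rewrite map_inj_in_uniq.
pose s x := nth x0 (extend (map t im)) (index x (extend im)).
have lt_index x : (index x (extend im) < size (extend (map t im)))%N.
  by rewrite size_extend // -(size_extend _ u1) index_mem.
have s_inj : injective s.
  move=> x y /eqP; rewrite /s nth_uniq ?extend_uniq // => /eqP e.
  by rewrite -[x](nth_index x0 (mem_extend im x)) e nth_index.
exists (perm s_inj) => h; rewrite permE /s /extend index_cat imP nth_cat.
by rewrite size_map index_mem imP (nth_map x0) ?index_mem // nth_index.
Qed.

Section Moments.
Variables (R : realType) (I : finType) (d : measure_display).
Variables (T : measurableType d) (P : probability T R) (n : nat).
Variable U : I -> T -> 'M[R[i]]_n.+1.
Hypothesis U_unitary : forall i, random_unitary (U i).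
Hypothesis U_symmetric : forall W : 'M[R[i]]_n.+1, signed_permutation W ->
  eq_joint_dist P
    (fun (p : off_diagonal I) w =>
       W ^t* *m rel_unitary U (val p).1 (val p).2 w *m W)
    (fun (p : off_diagonal I) w => rel_unitary U (val p).1 (val p).2 w).

Lemma rel_unitary_unitary i j w : rel_unitary U i j w \is unitarymx.
Proof. by rewrite mul_unitarymx ?trmxC_unitary //; exact: (U_unitary _).2. Qed.

Lemma bounded_measurable_rel i j a b :
  bounded_measurable (fun w => rel_unitary U i j w a b).
Proof.
split; last by exists 1 => w; rewrite unitarymx_entry_le1 ?rel_unitary_unitary.
under eq_fun do rewrite mxE.
apply: complex_measurable_sum => k; apply: complex_measurableM; last first.
  exact: (U_unitary j).1.
under eq_fun do rewrite !mxE.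
by apply: complex_measurable_conj; exact: (U_unitary i).1.
Qed.

Variables (m : nat) (idx : 'I_m.+1 -> I).
Hypothesis idx_neq : forall k, idx k != idx (ordS k).

Local Notation X := 'I_n.+1.
Implicit Types c : {ffun 'I_m.+1 -> X * X}.

Definition rel_product c w :=
  \prod_k rel_unitary U (idx k) (idx (ordS k)) w (c k).2 (c (ordS k)).1.

Lemma bounded_measurable_rel_product c : bounded_measurable (rel_product c).
Proof.
by apply: bounded_measurable_prod => k; exact: bounded_measurable_rel.
Qed.

Definition moment c := complex_expectation P (rel_product c).

Definition push (s : {perm X}) c : {ffun 'I_m.+1 -> X * X} :=
  [ffun k => (s (c k).1, s (c k).2)].

(** Conjugation by the signed permutation of [eps] and [s] relabels each entry and multiplies it by
    the signs of its row and column. *)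
Lemma moment_signed (eps : X -> R[i]) (s : {perm X}) c :
  (forall k, eps k = 1 \/ eps k = -1) ->
  moment c = (\prod_k (eps (s (c k).1) * eps (s (c k).2))) * moment (push s c).
Proof.
move=> eps1; pose W : 'M[R[i]]_n.+1 := \matrix_(k, j) (eps k * (k == s j)%:R).
have sW : signed_permutation W by exists eps, s.
pose p k : off_diagonal I := exist _ (idx k, idx (ordS k)) (idx_neq k).
pose phi (M : g_sigma_algebraType (@entry_cylinders R (off_diagonal I) n.+1)) :=
  \prod_k M (p k) (c k).2 (c (ordS k)).1.
have mphi : complex_measurable phi.
  by apply: complex_measurable_prod => k; exact: complex_measurable_entry.
have WE w : phi (fun q => W ^t* *m rel_unitary U (val q).1 (val q).2 w *m W) =
    (\prod_k (eps (s (c k).1) * eps (s (c k).2))) * rel_product (push s c) w.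
  rewrite /phi /rel_product.
  under eq_bigr do rewrite signed_permutation_conj //.
  rewrite big_split /=; congr (_ * _).
    rewrite !big_split /= mulrC; congr (_ * _).
    (* First ends enter through [ordS k]; the cyclic shift regroups the signs by edge. *)
    by rewrite [RHS](reindex (@ordS m.+1)) //; exact: onW_bij (ordS_bij _).
  by apply: eq_bigr => k _; rewrite !ffunE.
have bc := bounded_measurable_rel_product.
rewrite -complex_expectationZl //.
rewrite [LHS](_ : _ = complex_expectation P
  (fun w => phi (fun q => rel_unitary U (val q).1 (val q).2 w))) //.
rewrite -(eq_joint_dist_expectation (U_symmetric sW) mphi).
- by congr complex_expectation; apply/funext => w; rewrite WE.
- under eq_fun do rewrite WE.
  by apply: bounded_measurableM => //; exact: bounded_measurable_cst.
- exact: (bc c).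
Qed.

Lemma moment_kernel c c' :
  index_kernel c = index_kernel c' -> moment c = moment c'.
Proof.
move=> /perm_of_kernel[s sE].
rewrite (@moment_signed (fun=> 1) s); last by left.
rewrite big1 ?mul1r //.
congr moment; apply: half_edge_inj => h; rewrite sE.
by rewrite /half_edge ffunE; case: ifP.
Qed.

(** Reversing the sign of a value taken exactly once shows that the moment equals its own
    opposite. *)
Lemma moment_single c : ~ no_single c -> moment c = 0.
Proof.
move=> /existsNP[[j b] hj].
have single h : h != (j, b) -> half_edge c h != half_edge c (j, b).
  by move=> hh; apply/eqP => e; apply: hj; exists h.
pose eps x : R[i] := if x == half_edge c (j, b) then -1 else 1.
have eps1 x : eps x = 1 \/ eps x = -1.
  by rewrite /eps; case: ifP => _; [right|left].
have := moment_signed 1%g c eps1.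
have -> : push 1%g c = c.
  by apply/ffunP => k; rewrite ffunE !perm1 -surjective_pairing.
have eps_off h : h != (j, b) -> eps (half_edge c h) = 1.
  by move=> /single/negbTE; rewrite /eps => ->.
have eps_at : eps (half_edge c (j, b)) = -1 by rewrite /eps eqxx.
rewrite (bigD1 j) //= big1 => [|k kj]; last first.
  have e1 : eps (c k).1 = 1.
    by apply: (eps_off (k, false)); rewrite xpair_eqE (negbTE kj).
  have e2 : eps (c k).2 = 1.
    by apply: (eps_off (k, true)); rewrite xpair_eqE (negbTE kj).
  by rewrite !perm1 e1 e2 mulr1.
have -> : eps ((1%g : {perm X}) (c j).1) * eps ((1%g : {perm X}) (c j).2) = -1.
  have := eps_off (j, ~~ b); rewrite xpair_eqE eqxx !perm1.
  move: eps_at; rewrite /half_edge; case: (b) => /= -> /(_ isT) ->.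
    by rewrite mul1r.
  by rewrite mulr1.
rewrite mulr1 mulN1r => /eqP.
by rewrite -subr_eq0 opprK -mulr2n mulrn_eq0 => /eqP.
Qed.

Lemma moment_bound (b : R) c :
  (forall k x y, (complex_Lnorm P m.+1%:R
     (fun w => rel_unitary U (idx k) (idx (ordS k)) w x y) <= b%:E)%E) ->
  Normc.normc (moment c) <= (m.+1%:R * b ^+ m.+1) *+ 2.
Proof.
move=> Ub; rewrite -[X in X%:R](card_ord m.+1).
apply: (@normc_expectation_le _ _ _ _ _
  (fun k w => rel_unitary U (idx k) (idx (ordS k)) w (c k).2 (c (ordS k)).1)
  m.+1).
- exact: bounded_measurable_rel_product.
- by move=> k; exact: (bounded_measurable_rel _ _ _ _).1.
- move=> w; rewrite normc_prod.
  apply: le_trans (prod_le_sum_pow ord0 _) _ => [k|]; first exact: normc_ge0.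
  by rewrite card_ord.
- by move=> k; apply: moment_le.
Qed.

Lemma expectation_tr (A : 'I_m.+1 -> 'M[R[i]]_n.+1) :
  complex_expectation P (fun w =>
    \tr (\prod_(k < m.+1) (U (idx k) w *m A k *m (U (idx k) w) ^t*))) =
  \sum_(c : {ffun 'I_m.+1 -> X * X}) (\prod_k A k (c k).1 (c k).2) * moment c.
Proof.
under [X in complex_expectation P X]eq_fun do
  rewrite (tr_prod_conj (fun k => U (idx k) _) A (fun k => (U (idx k) _) ^t*)).
rewrite complex_expectation_sum // => c.
exact: bounded_measurable_rel_product.
Qed.

Local Notation L :=
  (#|{ffun ('I_m.+1 * bool) * ('I_m.+1 * bool) -> bool}|%:R : R).

(** The outer [L] bounds the number of kernels; the power [L ^+ m.+1] comes from loop removal, as at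
    most all [m.+1] edges are isolated loops. *)
Lemma expectation_tr_le (A : 'I_m.+1 -> 'M[R[i]]_n.+1) (b : R) :
  0 <= b -> (forall k, \tr (A k) = 0) ->
  (forall c, Normc.normc (moment c) <= b) ->
  Normc.normc (complex_expectation P (fun w =>
    \tr (\prod_(k < m.+1) (U (idx k) w *m A k *m (U (idx k) w) ^t*)))) <=
  L * (L ^+ m.+1 *
    \prod_k (Num.sqrt n.+1%:R * largest_singular_value (A k)) * b).
Proof.
move=> b0 trA mb; rewrite expectation_tr.
set B := _ * b.
have L0 : 0 <= L by exact: ler0n.
have B0 : 0 <= B.
  rewrite mulr_ge0 // mulr_ge0 ?exprn_ge0 //; apply: prodr_ge0 => k _.
  by rewrite mulr_ge0 ?sqrtr_ge0 // largest_singular_value_ge0.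
rewrite (partition_big (@index_kernel _ _) predT) //=.
apply: le_trans (normc_sum _ _ _) _.
rewrite mulr_natl -sumr_const; apply: ler_sum => q _.
have [c1 /eqP c1q|none] := pickP (fun c => index_kernel c == q); last first.
  by rewrite big_pred0 // Normc.normc0.
rewrite -c1q.
rewrite (eq_bigr (fun c => (\prod_k A k (c k).1 (c k).2) * moment c1));
  last first.
  by move=> c /eqP /moment_kernel ->.
rewrite -mulr_suml Normc.normcM.
have [ns|/moment_single ->] := pselect (no_single c1); last first.
  by rewrite Normc.normc0 mulr0.
apply: ler_pM; rewrite ?normc_ge0 //.
apply: le_trans
  (@norm_sum_kernel_le _ _ _ (fun k x y => A k x y) m.+1 c1 _ ns _) _.
- by move=> k; exact: trA.
- by rewrite (leq_trans (max_card _)) // card_ord.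
apply: ler_wpM2l; first exact: exprn_ge0.
by apply: ler_prod => k _; rewrite sqrtr_ge0 frobenius_le.
Qed.

End Moments.

(** * Choice of the uniform constant *)

Theorem theorem2p8 (R : realType) (I : finType)
    (d : nat -> measure_display) (T : forall n : nat, measurableType (d n))
    (P : forall n : nat, probability (T n) R)
    (U : forall n : nat, I -> T n -> 'M[R[i]]_n.+1)
    (U_unitary : forall (n : nat) (i : I), random_unitary (U n i))
    (U_symmetric : forall (n : nat) (W : 'M[R[i]]_n.+1),
       signed_permutation W ->
       eq_joint_dist (P n)
         (fun (p : off_diagonal I) w =>
            W ^t* *m rel_unitary (U n) (val p).1 (val p).2 w *m W)
         (fun (p : off_diagonal I) w =>
            rel_unitary (U n) (val p).1 (val p).2 w))
    (U_bounded : forall l : nat, (0 < l)%N ->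
       (ereal_sup [set x : \bar R |
          exists (n : nat) (i i' : I) (a b : 'I_n.+1), i != i' /\
            x = (Num.sqrt (n.+1%:R : R))%:E *
                complex_Lnorm (P n) l%:R
                  (fun w => rel_unitary (U n) i i' w a b)] < +oo)%E) :
  asymptotically_liberating P U.
Proof.
move=> [//|m] idx _ idx_neq.
pose L : R := #|{ffun ('I_m.+1 * bool) * ('I_m.+1 * bool) -> bool}|%:R.
have := U_bounded m.+1 isT; set sup := ereal_sup _ => sup_fin.
(* The supremum is [-oo] when [I] has no two distinct indices; then [M = 0] serves. *)
have [M M0 sup_le] : exists2 M : R, 0 <= M & (sup <= M%:E)%E.
  case: sup sup_fin => [r|//|] _; last by exists 0; rewrite ?leNye.
  by exists `|r|; rewrite ?lee_fin ?ler_norm.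
(* The size [n] is absent: the entry bounds [M / q], with [q] the square root of [n.+1], give [q] to
   the power [- m.+1], cancelling the factors [q] of the [m.+1] Frobenius norms. *)
exists (L * (L ^+ m.+1 * (m.+1%:R * M ^+ m.+1) *+ 2)) => n A trA.
pose q : R := Num.sqrt n.+1%:R.
have q0 : 0 < q by rewrite sqrtr_gt0.
have bound c : Normc.normc (moment (P n) (U n) idx c) <=
    (m.+1%:R * (M / q) ^+ m.+1) *+ 2.
  apply: moment_bound => // k x y.
  have : (q%:E * complex_Lnorm (P n) m.+1%:R
      (fun w => rel_unitary (U n) (idx k) (idx (ordS k)) w x y) <= M%:E)%E.
    apply: le_trans sup_le; apply: ereal_sup_ubound.
    by exists n, (idx k), (idx (ordS k)), x, y.
  by rewrite EFinM lee_pdivlMr // muleC.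
apply: le_trans
  (expectation_tr_le (U_unitary n) (@U_symmetric n) idx_neq _ trA bound) _.
  by rewrite mulrn_wge0 // mulr_ge0 // exprn_ge0 // divr_ge0 // ltW.
rewrite -/L big_split /= prodr_const card_ord -/q exprMn exprVn.
have qm : q ^+ m.+1 != 0 by rewrite expf_neq0 // gt_eqF.
rewrite le_eqVlt; apply/orP; left; apply/eqP.
by move: (q ^+ _) qm => r r0; field.
Qed.
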